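(* Let $m\le\hat n$ be positive integers. Consider the optimization problem over real $m\times\hat n$ matrices $\mathbf{A}$: $$\min_{\mathbf{A}\in\mathbb{R}^{m\times\hat n}}\ \left\|\mathbf{A}^T\mathbf{A}-\frac{m}{\hat n}\mathbf{I}_{\hat n}\right\|_F^2\quad\text{s.t.}\quad \mathrm{Tr}\left(\mathbf{A}^T\mathbf{A}\right)=m.$$ Its solutions are the $m\times\hat n$ Parseval tight frames; that is, a matrix $\mathbf{A}$ is a minimizer of this problem if and only if it is a Parseval tight frame.
   Context: $\|\cdot\|_F$ is the Frobenius norm. A matrix $\mathbf{A}\in\mathbb{R}^{m\times\hat n}$ is a frame with frame bounds $a,b>0$ if $a\|\mathbf{z}\|_2^2\le\|\mathbf{A}^T\mathbf{z}\|_2^2\le b\|\mathbf{z}\|_2^2$ for all $\mathbf{z}\in\mathbb{R}^m$; it is a Parseval tight frame if this holds with $a=b=1$ (equivalently $\mathbf{A}\mathbf{A}^T=\mathbf{I}_m$). *)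

(* Defs.v *)
From mathcomp Require Import all_boot all_order all_algebra.
From mathcomp Require Import reals.

Set Implicit Arguments.
Unset Strict Implicit.
Unset Printing Implicit Defensive.

Import Order.TTheory GRing.Theory Num.Theory.
Local Open Scope ring_scope.

(* The norm that mathcomp-analysis puts on matrices is the sup norm, hence the
   explicit definitions of the Frobenius and Euclidean norms. *)
Definition frobenius_norm (R : realType) (p q : nat) (M : 'M[R]_(p, q)) : R :=
  Num.sqrt (\sum_(i < p) \sum_(j < q) M i j ^+ 2).

Definition l2norm (R : realType) (p : nat) (z : 'cV[R]_p) : R :=
  Num.sqrt (\sum_(i < p) z i 0 ^+ 2).

(* The frame vectors are the columns of A; the bounds need not be optimal. *)
Definition frame_with_bounds (R : realType) (m n : nat) (a b : R)
    (A : 'M[R]_(m, n)) : Prop :=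
  [/\ 0 < a, 0 < b &
      forall z : 'cV[R]_m,
        a * l2norm z ^+ 2 <= l2norm (A^T *m z) ^+ 2 /\
        l2norm (A^T *m z) ^+ 2 <= b * l2norm z ^+ 2].

Definition parseval_tight_frame (R : realType) (m n : nat)
    (A : 'M[R]_(m, n)) : Prop :=
  frame_with_bounds 1 1 A.

Definition is_minimizer (R : realType) (T : Type) (feasible : T -> Prop)
    (f : T -> R) (x : T) : Prop :=
  feasible x /\ forall y : T, feasible y -> f x <= f y.

(* Main.v *)
Require Import Defs.
From mathcomp Require Import all_boot all_order all_algebra.
From mathcomp Require Import reals.
From mathcomp Require Import ring.
Import Order.TTheory GRing.Theory Num.Theory.
Local Open Scope ring_scope.

(** On the constraint [\tr (B^T *m B) = m], the objective and
    [frobenius_norm (B *m B^T - 1%:M) ^+ 2] differ by the constant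
    [m - m ^ 2 / n], because the two Gram matrices have the same trace and their
    squares have the same trace. The latter quantity is nonnegative, it vanishes
    exactly at the Parseval frames, and such frames exist as [m <= n]. *)

Lemma sqr_frobenius_norm (R : realType) (p q : nat) (M : 'M[R]_(p, q)) :
  frobenius_norm M ^+ 2 = \tr (M^T *m M).
Proof.
rewrite sqr_sqrtr; last by do 2 (apply: sumr_ge0 => ? _); exact: sqr_ge0.
rewrite exchange_big; apply: eq_bigr => j _; rewrite mxE.
by apply: eq_bigr => i _; rewrite mxE expr2.
Qed.

Lemma frobenius_norm_eq0 (R : realType) (p q : nat) (M : 'M[R]_(p, q)) :
  frobenius_norm M ^+ 2 = 0 -> M = 0.
Proof.
rewrite sqr_sqrtr; last by do 2 (apply: sumr_ge0 => ? _); exact: sqr_ge0.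
have row_ge0 i : 0 <= \sum_(j < q) M i j ^+ 2.
  by apply: sumr_ge0 => ? _; exact: sqr_ge0.
move=> /eqP; rewrite psumr_eq0 // => /allP M0; apply/matrixP => i j.
move: (M0 i (mem_index_enum i)); rewrite psumr_eq0 => [/allP Mi0|*]; last first.
  exact: sqr_ge0.
by move: (Mi0 j (mem_index_enum j)); rewrite sqrf_eq0 mxE => /eqP.
Qed.

Lemma sqr_l2norm (R : realType) (p : nat) (z : 'cV[R]_p) :
  l2norm z ^+ 2 = (z^T *m z) 0 0.
Proof.
rewrite sqr_sqrtr; last by apply: sumr_ge0 => ? _; exact: sqr_ge0.
by rewrite mxE; apply: eq_bigr => i _; rewrite mxE expr2.
Qed.

(** Polarization: by symmetry the two cross terms of the form at [x + y] agree, so twice the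
    bilinear form vanishes; basis vectors then read off the entries of [S]. *)
Lemma symmetric_quadratic_form_eq0 (R : realType) (p : nat) (S : 'M[R]_p) :
  S^T = S -> (forall z : 'cV[R]_p, z^T *m S *m z = 0) -> S = 0.
Proof.
move=> Ssym S0; apply/matrixP => i j.
have polar (x y : 'cV[R]_p) : x^T *m S *m y = 0.
  have sym : y^T *m S *m x = x^T *m S *m y.
    (* A 1 by 1 matrix equals its own transpose. *)
    rewrite [LHS]mx11_scalar -tr_scalar_mx -mx11_scalar.
    by rewrite !trmx_mul trmxK Ssym mulmxA.
  move: (S0 (x + y)); rewrite [(x + y)^T]linearD /= !mulmxDl !mulmxDr !S0 sym.
  rewrite add0r addr0 -mulr2n => /eqP.
  by rewrite -scaler_nat scaler_eq0 pnatr_eq0 => /eqP.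
move: (polar (delta_mx i 0) (delta_mx j 0)) => /matrixP /(_ 0 0).
by rewrite trmx_delta -rowE -colE !mxE.
Qed.

(** With both bounds equal to 1 the inequalities collapse to an equality between the quadratic forms
    of [A *m A^T] and the identity. Their difference is symmetric, hence zero. *)
Lemma parseval_tight_frameP (R : realType) (m n : nat) (A : 'M[R]_(m, n)) :
  parseval_tight_frame A <-> A *m A^T = 1%:M.
Proof.
have analysis z : l2norm (A^T *m z) ^+ 2 = (z^T *m (A *m A^T) *m z) 0 0.
  by rewrite sqr_l2norm trmx_mul trmxK !mulmxA.
split=> [[_ _ Abounds] | AAT].
  apply/subr0_eq; apply: symmetric_quadratic_form_eq0.
    by rewrite linearB /= trmx_mul trmxK trmx1.
  move=> z; rewrite mulmxBr mulmxBl mulmx1.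
  rewrite [X in X - _]mx11_scalar [X in _ - X]mx11_scalar -analysis -sqr_l2norm.
  have := Abounds z; rewrite !mul1r => -[lo hi].
  by rewrite (le_anti (introT andP (conj lo hi))) subrr.
split=> // z; rewrite analysis AAT mulmx1 -sqr_l2norm mul1r.
by split.
Qed.

(** The shape and [c] are left general to cover both Gram matrices: [B] with [c = m / n], and [B^T]
    with [c = 1]. *)
Lemma sqr_frobenius_norm_gram (R : realType) (p q : nat) (B : 'M[R]_(p, q))
    (c : R) :
  frobenius_norm (B^T *m B - c *: 1%:M) ^+ 2 =
  \tr (B^T *m B *m (B^T *m B)) - 2 * c * \tr (B^T *m B) + c ^+ 2 * q%:R.
Proof.
rewrite sqr_frobenius_norm [_^T]linearB /= [(c *: _)^T]linearZ /= trmx_mul trmxK trmx1.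
rewrite mulmxBl !mulmxBr -!scalemxAl -!scalemxAr !mulmx1 !mul1mx.
by rewrite !linearB /= !linearZ /= mxtrace1; ring.
Qed.

Lemma objective_parseval_defect (R : realType) (m n : nat) (B : 'M[R]_(m, n)) :
  (0 < n)%N -> \tr (B^T *m B) = m%:R ->
  frobenius_norm (B^T *m B - (m%:R / n%:R) *: 1%:M) ^+ 2 =
  frobenius_norm (B *m B^T - 1%:M) ^+ 2 + (m%:R - m%:R ^+ 2 / n%:R).
Proof.
move=> n_gt0 trB.
have n_neq0 : n%:R != 0 :> R by rewrite pnatr_eq0 -lt0n.
rewrite sqr_frobenius_norm_gram.
have := sqr_frobenius_norm_gram _ _ _ B^T 1; rewrite trmxK scale1r => ->.
rewrite [\tr (B *m B^T)]mxtrace_mulC trB.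
(* Moving the leading [B] to the end by cyclicity of the trace identifies the traces of the squares
   of the two Gram matrices. *)
rewrite -[B *m B^T *m _]mulmxA [\tr (B *m _)]mxtrace_mulC -!mulmxA.
by field.
Qed.

Theorem proposition2 (R : realType) (m n : nat)
    (m_gt0 : (0 < m)%N) (le_mn : (m <= n)%N) (A : 'M[R]_(m, n)) :
  is_minimizer
    (fun B : 'M[R]_(m, n) => \tr (B^T *m B) = m%:R)
    (fun B : 'M[R]_(m, n) =>
       frobenius_norm (B^T *m B - (m%:R / n%:R) *: 1%:M) ^+ 2)
    A
  <-> parseval_tight_frame A.
Proof.
have n_gt0 := leq_trans m_gt0 le_mn.
rewrite parseval_tight_frameP.
have feasible (B : 'M[R]_(m, n)) : B *m B^T = 1%:M -> \tr (B^T *m B) = m%:R.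
  by rewrite mxtrace_mulC => ->; rewrite mxtrace1.
have defect0 (B : 'M[R]_(m, n)) :
    B *m B^T = 1%:M -> frobenius_norm (B *m B^T - 1%:M) ^+ 2 = 0.
  by move=> ->; rewrite subrr sqr_frobenius_norm mulmx0 mxtrace0.
split=> [[trA minA] | AAT].
  (* The competitor is the identity block padded with [n - m] zero columns, a Parseval frame because
     [m <= n]. *)
  pose P : 'M[R]_(m, n) := pid_mx m.
  have PPT : P *m P^T = 1%:M.
    by rewrite tr_pid_mx mul_pid_mx minnn (minn_idPr le_mn) pid_mx_1.
  have trP := feasible P PPT; have := minA P trP.
  rewrite !objective_parseval_defect // (defect0 P) // lerD2r => defectA.
  (* Comparison with [P] bounds the squared defect of [A] above by 0. *)
  apply/subr0_eq/frobenius_norm_eq0/le_anti.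
  by rewrite defectA sqr_ge0.
have trA := feasible A AAT; split=> // B trB.
rewrite !objective_parseval_defect // (defect0 A) // lerD2r.
exact: sqr_ge0.
Qed.
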